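(* Every strongly $\aleph_1$-free abelian group is n-slender, cm-slender, and lcH-slender.
   Context: An abelian group is $\aleph_1$-free abelian if every countable subgroup is free abelian. If $H$ is $\aleph_1$-free abelian, a subgroup $M\le H$ is $\aleph_1$-pure if $M$ is a direct summand of $\langle M\cup X\rangle$ for every countable set $X\subseteq H$. An $\aleph_1$-free abelian group $H$ is strongly $\aleph_1$-free abelian if every countable subset of $H$ is contained in a countably generated $\aleph_1$-pure subgroup of $H$. A group $H$ is cm-slender if every abstract homomorphism from a completely metrizable topological group to $H$ has open kernel; $H$ is lcH-slender if every abstract homomorphism from a locally compact Hausdorff topological group to $H$ has open kernel. The Hawaiian earring group $\mathcal{H}$: fix letters $\{a_n^{\pm1}\}_{n\in\omega}$. A word is a function $W:\overline{W}\to\{a_n^{\pm1}\}_{n\in\omega}$ whose domain $\overline{W}$ is a totally ordered set such that for each $m$ the preimage $W^{-1}(\{a_n^{\pm1}\}_{n=0}^m)$ is finite; words are identified up to order isomorphism of domains preserving letters. For $m\in\omega$, $p_m(W)$ is the restriction of $W$ to $\{i: W(i)\in\{a_n^{\pm1}\}_{n=0}^m\}$, a finite word. Two words $W,U$ are equivalent if for every $m$, $p_m(W)$ and $p_m(U)$ are equal in the free group $F(a_0,\dots,a_m)$. $\mathcal{H}$ is the set of equivalence classes with multiplication induced by concatenation (ordered disjoint union of domains, first word below second) and inverse induced by reversing the order and inverting letters. $p_m$ induces a retraction homomorphism $p_m:\mathcal{H}\to\mathcal{H}_m$ onto the subgroup $\mathcal{H}_m\cong F(a_0,\dots,a_m)$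 of classes of finite words in $a_0,\dots,a_m$. $\mathcal{H}^m$ denotes the subgroup of elements having a representative word using no letter from $\{a_n^{\pm1}\}_{n=0}^m$. A group $H$ is n-slender if for every homomorphism $\phi:\mathcal{H}\to H$ there is $m\in\omega$ with $\phi=\phi\circ p_m$, equivalently $\mathcal{H}^m\le\ker\phi$. *)

(* Defs.v *)
From Stdlib Require Import Reals ZArith List Sorting.Sorted Relations.
Import ListNotations.

Record AbGroup := {
  ab_car :> Type;
  ab_add : ab_car -> ab_car -> ab_car;
  ab_zero : ab_car;
  ab_neg : ab_car -> ab_car;
  ab_addA : forall x y z, ab_add x (ab_add y z) = ab_add (ab_add x y) z;
  ab_addC : forall x y, ab_add x y = ab_add y x;
  ab_add0 : forall x, ab_add ab_zero x = x;
  ab_addN : forall x, ab_add (ab_neg x) x = ab_zero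
}.

Section AbDefs.
Variable H : AbGroup.

Definition is_subgroup (S : H -> Prop) : Prop :=
  S (ab_zero H) /\ (forall x y, S x -> S y -> S (ab_add H x y)) /\
  (forall x, S x -> S (ab_neg H x)).

(* X is countable: contained in the range of a sequence (empty set allowed) *)
Definition countable_set (X : H -> Prop) : Prop :=
  exists f : nat -> H, forall x, X x -> exists n, f n = x.

Fixpoint nmul (n : nat) (x : H) : H :=
  match n with O => ab_zero H | S k => ab_add H x (nmul k x) end.

Definition zmul (z : Z) (x : H) : H :=
  match z with
  | Z0 => ab_zero H
  | Zpos p => nmul (Pos.to_nat p) x
  | Zneg p => ab_neg H (nmul (Pos.to_nat p) x)
  end.

Definition lincomb (l : list (Z * H)) : H :=
  fold_right (fun p acc => ab_add H (zmul (fst p) (snd p)) acc) (ab_zero H) l.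

Definition free_abelian_subgroup (S : H -> Prop) : Prop :=
  exists B : H -> Prop,
    (forall b, B b -> S b) /\
    (forall l : list (Z * H), NoDup (map snd l) -> Forall (fun p => B (snd p)) l ->
        lincomb l = ab_zero H -> Forall (fun p => fst p = 0%Z) l) /\
    (forall x, S x -> exists l : list (Z * H),
        Forall (fun p => B (snd p)) l /\ lincomb l = x).

Definition aleph1_free : Prop :=
  forall S, is_subgroup S -> countable_set S -> free_abelian_subgroup S.

Definition gen (Y : H -> Prop) : H -> Prop :=
  fun x => forall S, is_subgroup S -> (forall y, Y y -> S y) -> S x.

Definition direct_summand (M K : H -> Prop) : Prop :=
  exists C : H -> Prop, is_subgroup C /\ (forall c, C c -> K c) /\
    (forall x, M x -> C x -> x = ab_zero H) /\
    (forall k, K k -> exists a c, M a /\ C c /\ k = ab_add H a c).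

Definition aleph1_pure (M : H -> Prop) : Prop :=
  is_subgroup M /\
  forall X, countable_set X -> direct_summand M (gen (fun x => M x \/ X x)).

Definition countably_generated (M : H -> Prop) : Prop :=
  exists Y, countable_set Y /\ forall x, M x <-> gen Y x.

Definition strongly_aleph1_free : Prop :=
  aleph1_free /\
  forall X, countable_set X ->
    exists M, is_subgroup M /\ countably_generated M /\ aleph1_pure M /\
              (forall x, X x -> M x).
End AbDefs.

Record TopGroup := {
  tg_car :> Type;
  tg_mul : tg_car -> tg_car -> tg_car;
  tg_one : tg_car;
  tg_inv : tg_car -> tg_car;
  tg_mulA : forall x y z, tg_mul x (tg_mul y z) = tg_mul (tg_mul x y) z;
  tg_mul1 : forall x, tg_mul tg_one x = x;
  tg_mulV : forall x, tg_mul (tg_inv x) x = tg_one;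
  tg_open : (tg_car -> Prop) -> Prop;
  tg_open_full : tg_open (fun _ => True);
  tg_open_inter : forall U V, tg_open U -> tg_open V -> tg_open (fun x => U x /\ V x);
  tg_open_union : forall F : (tg_car -> Prop) -> Prop,
      (forall U, F U -> tg_open U) -> tg_open (fun x => exists U, F U /\ U x);
  tg_mul_cont : forall U x y, tg_open U -> U (tg_mul x y) ->
      exists V W, tg_open V /\ tg_open W /\ V x /\ W y /\
        (forall a b, V a -> W b -> U (tg_mul a b));
  tg_inv_cont : forall U, tg_open U -> tg_open (fun x => U (tg_inv x))
}.

Section TopDefs.
Variable G : TopGroup.
Open Scope R_scope.

Definition is_metric (d : G -> G -> R) : Prop :=
  (forall x y, 0 <= d x y) /\ (forall x y, d x y = 0 <-> x = y) /\
  (forall x y, d x y = d y x) /\ (forall x y z, d x z <= d x y + d y z).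

Definition completely_metrizable : Prop :=
  exists d : G -> G -> R, is_metric d /\
    (forall U, tg_open G U <->
       forall x, U x -> exists eps, 0 < eps /\ forall y, d x y < eps -> U y) /\
    (forall s : nat -> G,
       (forall eps, 0 < eps -> exists N, forall n k, (N <= n)%nat -> (N <= k)%nat ->
          d (s n) (s k) < eps) ->
       exists x, forall eps, 0 < eps -> exists N, forall n, (N <= n)%nat -> d (s n) x < eps).

Definition compact_set (K : G -> Prop) : Prop :=
  forall F : (G -> Prop) -> Prop, (forall U, F U -> tg_open G U) ->
    (forall x, K x -> exists U, F U /\ U x) ->
    exists l : list (G -> Prop), Forall F l /\ (forall x, K x -> exists U, In U l /\ U x).

Definition hausdorff : Prop :=
  forall x y : G, x <> y -> exists U V, tg_open G U /\ tg_open G V /\ U x /\ V y /\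
     (forall z, U z -> V z -> False).

Definition locally_compact : Prop :=
  forall x : G, exists U K, tg_open G U /\ U x /\ (forall y, U y -> K y) /\ compact_set K.
End TopDefs.

Definition tg_hom (G : TopGroup) (H : AbGroup) (phi : G -> H) : Prop :=
  forall x y, phi (tg_mul G x y) = ab_add H (phi x) (phi y).

Definition open_kernel (G : TopGroup) (H : AbGroup) (phi : G -> H) : Prop :=
  tg_open G (fun x => phi x = ab_zero H).

Definition cm_slender (H : AbGroup) : Prop :=
  forall (G : TopGroup), completely_metrizable G ->
    forall phi : G -> H, tg_hom G H phi -> open_kernel G H phi.

Definition lcH_slender (H : AbGroup) : Prop :=
  forall (G : TopGroup), locally_compact G -> hausdorff G ->
    forall phi : G -> H, tg_hom G H phi -> open_kernel G H phi.

(* letter (n, true) = a_n, (n, false) = a_n^{-1} *)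
Definition letter := (nat * bool)%type.

Record RawWord := {
  w_dom : Type;
  w_lt : w_dom -> w_dom -> Prop;
  w_let : w_dom -> letter
}.

Definition is_word (W : RawWord) : Prop :=
  (forall i, ~ w_lt W i i) /\
  (forall i j k, w_lt W i j -> w_lt W j k -> w_lt W i k) /\
  (forall i j, w_lt W i j \/ i = j \/ w_lt W j i) /\
  (forall m, exists l : list (w_dom W), forall i, fst (w_let W i) <= m -> In i l).

Definition proj_rep (W : RawWord) (m : nat) (l : list letter) : Prop :=
  exists ds : list (w_dom W),
    (forall i, In i ds <-> fst (w_let W i) <= m) /\
    StronglySorted (w_lt W) ds /\ l = map (w_let W) ds.

Definition free_step (l1 l2 : list letter) : Prop :=
  exists a b n s, l1 = a ++ (n, s) :: (n, negb s) :: b /\ l2 = a ++ b.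

Definition free_eq : list letter -> list letter -> Prop :=
  clos_refl_sym_trans _ free_step.

Definition word_equiv (W U : RawWord) : Prop :=
  forall m l1 l2, proj_rep W m l1 -> proj_rep U m l2 -> free_eq l1 l2.

Definition word_concat (W U : RawWord) : RawWord := {|
  w_dom := (w_dom W + w_dom U)%type;
  w_lt := fun a b => match a, b with
            | inl x, inl y => w_lt W x y
            | inr x, inr y => w_lt U x y
            | inl _, inr _ => True
            | inr _, inl _ => False
            end;
  w_let := fun a => match a with inl x => w_let W x | inr y => w_let U y end
|}.

Definition word_restrict (m : nat) (W : RawWord) : RawWord := {|
  w_dom := { i : w_dom W | fst (w_let W i) <= m };
  w_lt := fun a b => w_lt W (proj1_sig a) (proj1_sig b);
  w_let := fun a => w_let W (proj1_sig a)
|}.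

(* phi is (the lift to words of) a homomorphism  Hawaiian earring group -> H *)
Definition hawaiian_hom (H : AbGroup) (phi : RawWord -> H) : Prop :=
  (forall W U, is_word W -> is_word U -> word_equiv W U -> phi W = phi U) /\
  (forall W U, is_word W -> is_word U -> phi (word_concat W U) = ab_add H (phi W) (phi U)).

Definition n_slender (H : AbGroup) : Prop :=
  forall phi : RawWord -> H, hawaiian_hom H phi ->
    exists m, forall W, is_word W -> phi W = phi (word_restrict m W).

(* Main.v *)
(** If a homomorphism [phi] to [H] violates slenderness, there are arbitrarily small
    elements [g n] (close to the identity, or words in letters of large index) with
    [phi (g n) <> 0]; as [H] is aleph_1-free, [phi (g n)] is not divisible by some [k n >= 2].
    When the [g n] tend to the identity fast enough, the equations
    [x n = (g n)^(e n) * (x (n+1))^(k n)] have a solution for every binary sequence [e]: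
    a limit of partial products in a complete metric group, a cluster point of them in a
    compact neighbourhood, or an explicit infinite word.
    A countable aleph_1-pure subgroup [M] contains all [phi (g n)].  Modulo [M] the
    element [phi (x 0)] is divisible by all [k 0 * ... * k n], hence it lies in [M].
    Since [M] is countable, two different [e] give the same [phi (x 0)], and at the first
    place [n] where they differ torsion-freeness makes [phi (g n)] divisible by [k n]. *)

From Stdlib Require Import Reals ZArith List Lia Lra Sorting.Sorted Relations Cantor.
From Stdlib Require Import Classical ClassicalEpsilon.
From Stdlib Require Import FunctionalExtensionality PropExtensionality ProofIrrelevance.
Require Import Defs.
Import ListNotations.

Declare Scope ab_scope.
Delimit Scope ab_scope with ab.
Local Notation "x + y" := (ab_add _ x y) : ab_scope.
Local Notation "- x" := (ab_neg _ x) : ab_scope.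
Local Notation "0" := (ab_zero _) : ab_scope.

Lemma pred_ext {T : Type} (P Q : T -> Prop) : (forall x, P x <-> Q x) -> P = Q.
Proof.
  intros E. apply functional_extensionality. intros x.
  apply propositional_extensionality. apply E.
Qed.

(** * Arithmetic in abelian groups *)

Section AbelianGroup.
Variable H : AbGroup.
Implicit Types x y z : H.
Local Open Scope ab_scope.

Lemma add0r x : x + 0 = x.
Proof. rewrite ab_addC. apply ab_add0. Qed.

Lemma addNr x : x + - x = 0.
Proof. rewrite ab_addC. apply ab_addN. Qed.

Lemma addKl x y : - x + (x + y) = y.
Proof. rewrite ab_addA, ab_addN. apply ab_add0. Qed.

Lemma add_cancel_l x y z : x + y = x + z -> y = z.
Proof. intros E. rewrite <- (addKl x y), E. apply addKl. Qed.

Lemma add_cancel_r x y z : y + x = z + x -> y = z.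
Proof. rewrite !(ab_addC _ _ x). apply add_cancel_l. Qed.

Lemma neg_unique x y : x + y = 0 -> y = - x.
Proof. intros E. apply (add_cancel_l x). now rewrite addNr. Qed.

Lemma opp_inv x : - - x = x.
Proof. symmetry. apply neg_unique, ab_addN. Qed.

Lemma opp0 : - 0 = (0 : H).
Proof. symmetry. apply neg_unique, ab_add0. Qed.

Lemma add_swap x y z (w : H) : (x + y) + (z + w) = (x + z) + (y + w).
Proof.
  rewrite <- !ab_addA. f_equal. rewrite !ab_addA. f_equal. apply ab_addC.
Qed.

Lemma opp_add x y : - (x + y) = - x + - y.
Proof. symmetry. apply neg_unique. now rewrite add_swap, !addNr, ab_add0. Qed.

Lemma sub_eq0 x y : x + - y = 0 -> x = y.
Proof. intros E. apply (add_cancel_r (- y)). now rewrite addNr. Qed.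

Lemma nmul_add n x y : nmul H n (x + y) = nmul H n x + nmul H n y.
Proof.
  induction n as [|n IH]; simpl.
  - now rewrite ab_add0.
  - rewrite IH. apply add_swap.
Qed.

Lemma nmul_opp n x : nmul H n (- x) = - nmul H n x.
Proof.
  induction n as [|n IH]; simpl.
  - symmetry. apply opp0.
  - now rewrite IH, opp_add.
Qed.

Lemma zmul_of_nat n x : zmul H (Z.of_nat n) x = nmul H n x.
Proof. destruct n; [easy|]. simpl zmul. now rewrite SuccNat2Pos.id_succ. Qed.

Lemma zmul_opp a x : zmul H (- a) x = - zmul H a x.
Proof.
  destruct a; simpl; [|easy|].
  - now rewrite opp0.
  - now rewrite opp_inv.
Qed.

Lemma zmul_succ a x : zmul H (Z.succ a) x = x + zmul H a x.
Proof.
  destruct (Z_le_gt_dec 0 a) as [Ha|Ha].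
  - rewrite <- (Z2Nat.id a Ha), <- Nat2Z.inj_succ. now rewrite !zmul_of_nat.
  - replace a with (- Z.of_nat (S (Z.to_nat (- a - 1))))%Z by lia.
    set (n := Z.to_nat _).
    replace (Z.succ (- Z.of_nat (S n))) with (- Z.of_nat n)%Z by lia.
    rewrite !zmul_opp, !zmul_of_nat. simpl.
    now rewrite opp_add, ab_addA, addNr, ab_add0.
Qed.

Lemma zmul_add a b x : zmul H (a + b) x = zmul H a x + zmul H b x.
Proof.
  revert a. apply Z.peano_ind.
  - simpl. now rewrite ab_add0.
  - intros a IH. now rewrite Z.add_succ_l, !zmul_succ, IH, ab_addA.
  - intros a IH. apply (add_cancel_l x).
    rewrite ab_addA, <- !zmul_succ, <- Z.add_succ_l, Z.succ_pred. exact IH.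
Qed.

(** * Linear combinations and coordinates with respect to a basis *)

Lemma lincomb_app l l' : lincomb H (l ++ l') = lincomb H l + lincomb H l'.
Proof.
  induction l as [|p l IH]; simpl.
  - now rewrite ab_add0.
  - now rewrite IH, ab_addA.
Qed.

Definition lopp (l : list (Z * H)) := map (fun p => (- fst p, snd p)%Z) l.

Lemma lincomb_lopp l : lincomb H (lopp l) = - lincomb H l.
Proof.
  induction l as [|p l IH]; simpl.
  - now rewrite opp0.
  - now rewrite zmul_opp, IH, opp_add.
Qed.

(** All occurrences of [b] are added up, because a spanning list may repeat a basis element. *)
Definition coef (b : H) (l : list (Z * H)) : Z :=
  fold_right (fun p acc =>
    ((if excluded_middle_informative (snd p = b) then fst p else 0) + acc)%Z) 0%Z l.

Lemma coef_app b l l' : coef b (l ++ l') = (coef b l + coef b l')%Z.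
Proof. induction l as [|p l IH]; simpl; [easy|]. rewrite IH. lia. Qed.

Lemma coef_lopp b l : coef b (lopp l) = (- coef b l)%Z.
Proof.
  induction l as [|p l IH]; simpl; [easy|].
  rewrite IH. destruct (excluded_middle_informative _); lia.
Qed.

Lemma coef_notin b l : ~ In b (map snd l) -> coef b l = 0%Z.
Proof.
  induction l as [|p l IH]; simpl; intros N; [easy|].
  rewrite IH by tauto. destruct (excluded_middle_informative _); [tauto|lia].
Qed.

Lemma coef_NoDup l p : NoDup (map snd l) -> In p l -> coef (snd p) l = fst p.
Proof.
  induction l as [|q l IH]; [easy|]. simpl. intros D [E|I].
  - subst q. inversion_clear D as [|? ? N D']. rewrite coef_notin by easy.
    destruct (excluded_middle_informative _); [lia|tauto].
  - inversion_clear D as [|? ? N D']. rewrite IH by easy.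
    destruct (excluded_middle_informative _) as [E|]; [|lia].
    exfalso. apply N. rewrite E. now apply in_map.
Qed.

Lemma insert_NoDup (a : Z) (b : H) l : NoDup (map snd l) ->
  exists l', NoDup (map snd l') /\
    (forall c, In c (map snd l') -> c = b \/ In c (map snd l)) /\
    lincomb H l' = zmul H a b + lincomb H l /\
    forall c, coef c l' = coef c ((a, b) :: l).
Proof.
  induction l as [|[a' b'] l IH]; intros D.
  - exists [(a, b)]. repeat split.
    + constructor; [easy|constructor].
    + simpl. intuition.
  - simpl in D. inversion_clear D as [|? ? N D'].
    destruct (excluded_middle_informative (b' = b)) as [E|E].
    + subst b'. exists (((a + a')%Z, b) :: l). repeat split.
      * now constructor.
      * simpl. intuition.
      * simpl. now rewrite zmul_add, ab_addA.
      * intros c. simpl. destruct (excluded_middle_informative _); lia.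
    + destruct (IH D') as (l' & D1 & I1 & L1 & C1).
      exists ((a', b') :: l'). repeat split.
      * simpl. constructor; [|easy]. intros I. apply I1 in I. tauto.
      * simpl. intros c [I|I]; [tauto|]. apply I1 in I. tauto.
      * simpl. rewrite L1, !ab_addA. f_equal. apply ab_addC.
      * intros c. specialize (C1 c). simpl in *. lia.
Qed.

(** Independence speaks of lists without repetition, spanning of arbitrary lists; merging repeated
    entries connects the two. *)
Lemma collect_NoDup (B : H -> Prop) l : Forall (fun p => B (snd p)) l ->
  exists l', NoDup (map snd l') /\ Forall (fun p => B (snd p)) l' /\
    lincomb H l' = lincomb H l /\ forall c, coef c l' = coef c l.
Proof.
  induction 1 as [|[a b] l Hb _ (l1 & D1 & F1 & L1 & C1)].
  - exists []. repeat split; constructor.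
  - destruct (insert_NoDup a b l1 D1) as (l2 & D2 & I2 & L2 & C2).
    exists l2. repeat split; [easy| | |].
    + apply Forall_forall. intros p Ip.
      destruct (I2 (snd p) (in_map snd _ _ Ip)) as [E|I].
      * now rewrite E.
      * apply in_map_iff in I as (q & Eq & Iq). rewrite <- Eq.
        rewrite Forall_forall in F1. now apply F1.
    + simpl. now rewrite L2, L1.
    + intros c. rewrite C2. simpl. now rewrite C1.
Qed.

Lemma lincomb_all0 l : Forall (fun p => fst p = 0%Z) l -> lincomb H l = 0.
Proof.
  induction 1 as [|p l E _ IH]; simpl; [easy|]. rewrite E, IH. apply ab_add0.
Qed.

Lemma coef_all0 b l : Forall (fun p => fst p = 0%Z) l -> coef b l = 0%Z.
Proof.
  induction 1 as [|p l E _ IH]; simpl; [easy|].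
  rewrite E, IH. now destruct (excluded_middle_informative _).
Qed.

(* The separating functional is a coordinate with respect to a basis of [S]. *)
Lemma free_abelian_separating (S : H -> Prop) x :
  is_subgroup H S -> free_abelian_subgroup H S -> S x -> x <> 0 ->
  exists f : H -> Z, (forall y z, S y -> S z -> f (y + z) = (f y + f z)%Z) /\ f x <> 0%Z.
Proof.
  intros (_ & Sadd & _) (B & _ & ind & span) Sx nx.
  assert (ex : forall y, exists l, S y -> Forall (fun p => B (snd p)) l /\ lincomb H l = y).
  { intros y. destruct (classic (S y)) as [Sy|nSy].
    - destruct (span y Sy) as [l Hl]. now exists l.
    - exists []. tauto. }
  destruct (choice _ ex) as [L HL]. clear ex.
  assert (coef0 : forall l, Forall (fun p => B (snd p)) l -> lincomb H l = 0 ->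
            forall b, coef b l = 0%Z).
  { intros l Fl El b. destruct (collect_NoDup B l Fl) as (l' & D & F & E & C).
    rewrite <- C. apply coef_all0, ind; [easy..|]. now rewrite E. }
  assert (nz : exists b, coef b (L x) <> 0%Z).
  { apply NNPP. intros N. apply nx. destruct (HL x Sx) as [Fx Ex].
    destruct (collect_NoDup B _ Fx) as (l' & D & F & E & C).
    rewrite <- Ex, <- E. apply lincomb_all0, Forall_forall. intros p Ip.
    rewrite <- (coef_NoDup _ _ D Ip), C. apply NNPP. intros Np. apply N. now exists (snd p). }
  destruct nz as [b nb]. exists (fun y => coef b (L y)). split; [|easy].
  intros y z Sy Sz.
  destruct (HL y Sy) as [Fy Ey], (HL z Sz) as [Fz Ez], (HL _ (Sadd _ _ Sy Sz)) as [Fs Es].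
  (* [L (y + z)] minus [L y] and [L z] represents 0, so its coefficients vanish; this is additivity
     of the coordinate. *)
  assert (E : coef b (L (y + z) ++ lopp (L y ++ L z)) = 0%Z).
  { apply coef0.
    - apply Forall_app. split; [easy|]. unfold lopp. apply Forall_map.
      apply Forall_app. now split.
    - rewrite lincomb_app, lincomb_lopp, lincomb_app, Ey, Ez, Es. apply addNr. }
  rewrite coef_app, coef_lopp, coef_app in E. lia.
Qed.

(** * Countability of generated subgroups *)

Lemma gen_subgroup (Y : H -> Prop) : is_subgroup H (gen H Y).
Proof.
  repeat split.
  - intros S (S0 & _) _. exact S0.
  - intros x y Gx Gy S HS HY. apply HS; [now apply Gx|now apply Gy].
  - intros x Gx S HS HY. apply HS. now apply Gx.
Qed.

Lemma gen_incl (Y : H -> Prop) x : Y x -> gen H Y x.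
Proof. intros Yx S _ HY. now apply HY. Qed.

(* Every element of the subgroup is a sum of [m] terms, each a generator or the
   opposite of one; [signed_sum f m] decodes the terms from a number. *)
Definition signed_term (f : nat -> H) (a : nat) : H :=
  let (i, j) := of_nat a in match j with O => f i | S _ => - f i end.

Fixpoint signed_sum (f : nat -> H) (m n : nat) : H :=
  match m with
  | O => 0
  | S m' => let (a, b) := of_nat n in signed_term f a + signed_sum f m' b
  end.

Lemma signed_term_opp f a : exists a', signed_term f a' = - signed_term f a.
Proof.
  unfold signed_term at 2. destruct (of_nat a) as [i [|j]].
  - exists (to_nat (i, 1)). unfold signed_term. now rewrite cancel_of_to.
  - exists (to_nat (i, O)). unfold signed_term. now rewrite cancel_of_to, opp_inv.
Qed.

(** The values of [signed_sum f] form a subgroup containing [Y], hence contain everything that [Y]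
    generates. *)
Lemma gen_countable (Y : H -> Prop) : countable_set H Y -> countable_set H (gen H Y).
Proof.
  intros [f Hf].
  exists (fun p => let (m, n) := of_nat p in signed_sum f m n).
  intros x Gx.
  cut (exists m n, signed_sum f m n = x).
  { intros (m & n & E). exists (to_nat (m, n)). now rewrite cancel_of_to. }
  apply (Gx (fun x => exists m n, signed_sum f m n = x)).
  - repeat split.
    + now exists O, O.
    + intros y z (m & n & <-) (m' & n' & <-). revert n.
      induction m as [|m IH]; intros n; simpl.
      * exists m', n'. now rewrite ab_add0.
      * destruct (of_nat n) as [a b]. destruct (IH b) as (m1 & n1 & E).
        exists (S m1), (to_nat (a, n1)). cbn [signed_sum]. now rewrite cancel_of_to, E, ab_addA.
    + intros y (m & n & <-). exists m. revert n.
      induction m as [|m IH]; intros n; simpl.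
      * exists O. now rewrite opp0.
      * destruct (of_nat n) as [a b]. destruct (IH b) as (n1 & E).
        destruct (signed_term_opp f a) as [a' Ea].
        exists (to_nat (a', n1)). now rewrite cancel_of_to, E, Ea, opp_add.
  - intros y Yy. destruct (Hf y Yy) as [i <-].
    exists 1, (to_nat (to_nat (i, O), O)). cbn [signed_sum]. rewrite cancel_of_to.
    unfold signed_term. rewrite cancel_of_to. apply add0r.
Qed.

Lemma nmul_closed (S : H -> Prop) n x : is_subgroup H S -> S x -> S (nmul H n x).
Proof. intros (S0 & Sa & _) Sx. induction n as [|n IH]; simpl; auto. Qed.

(** * Divisibility in aleph_1-free groups *)

Section AlephOneFree.
Hypothesis free : aleph1_free H.

(** The terms of [c] generate a countable, hence free, subgroup with additive coordinates. Only
    multiples among the terms are recorded, since the uses are divisibility arguments along a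
    sequence. *)
Lemma aleph1_free_separating (c : nat -> H) x : x <> 0 -> (exists n, c n = x) ->
  exists f : H -> Z, f x <> 0%Z /\
    forall m k n, c m = nmul H k (c n) -> f (c m) = (Z.of_nat k * f (c n))%Z.
Proof.
  intros nx ex. set (S := gen H (fun y => exists n, c n = y)).
  assert (HS : is_subgroup H S) by apply gen_subgroup.
  assert (Sc : forall n, S (c n)) by (intros n; apply gen_incl; now exists n).
  destruct (free_abelian_separating S x) as (f & fadd & fx); trivial.
  - apply free; [easy|]. apply gen_countable. exists c. trivial.
  - now apply gen_incl.
  - exists f. split; [easy|]. intros m k n E. rewrite E. clear E m.
    assert (f0 : f 0 = 0%Z).
    { assert (E := fadd 0 0 (proj1 HS) (proj1 HS)). rewrite ab_add0 in E. lia. }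
    induction k as [|k IH]; simpl nmul; [easy|].
    rewrite fadd, IH; [lia|easy|]. now apply nmul_closed.
Qed.

Lemma aleph1_free_torsion_free k x : k <> 0%nat -> nmul H k x = 0 -> x = 0.
Proof.
  intros nk E. apply NNPP. intros nx.
  (* The sequence [0, x, x, ...] turns [k x = 0] into [k * f x = f 0]; the multiplier 0 gives
     [f 0 = 0]. *)
  destruct (aleph1_free_separating (fun n => match n with O => 0 | _ => x end) x nx)
    as (f & fx & fm).
  - now exists 1%nat.
  - assert (E1 := fm 0%nat k 1%nat (eq_sym E)).
    assert (E0 := fm 0%nat 0%nat 1%nat eq_refl). simpl in *. nia.
Qed.

Lemma nmul_injective k x y : k <> 0%nat -> nmul H k x = nmul H k y -> x = y.
Proof.
  intros nk E. apply sub_eq0, (aleph1_free_torsion_free k); [easy|].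
  now rewrite nmul_add, nmul_opp, E, addNr.
Qed.

(** Otherwise the nonzero integer [f x] would be divisible by every [k >= 2], in particular by
    [|f x| + 2]. *)
Lemma aleph1_free_nondivisor x : x <> 0 ->
  exists k, (2 <= k)%nat /\ forall y, x <> nmul H k y.
Proof.
  intros nx. apply NNPP. intros N.
  assert (ex : forall k, exists y, (2 <= k)%nat -> x = nmul H k y).
  { intros k. apply NNPP. intros Nk. apply N. exists k. split.
    - apply NNPP. intros L. apply Nk. exists 0. tauto.
    - intros y E. apply Nk. now exists y. }
  destruct (choice _ ex) as [y Hy].
  destruct (aleph1_free_separating (fun n => match n with O => x | S k => y k end) x nx)
    as (f & fx & fm).
  - now exists 0%nat.
  - set (k := S (S (Z.abs_nat (f x)))).
    assert (E : f x = (Z.of_nat k * f (y k))%Z) by exact (fm 0%nat k (S k) (Hy k ltac:(lia))).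
    assert (Hk : (Z.abs (f x) < Z.of_nat k)%Z) by lia.
    clearbody k. destruct (Z.eq_dec (f (y k)) 0); nia.
Qed.

(** If [c 0] were nonzero, the positive integers [|f (c n)|] would drop by at least one at each
    step, forever. *)
Lemma aleph1_free_chain (k : nat -> nat) (c : nat -> H) :
  (forall n, 2 <= k n)%nat -> (forall n, c n = nmul H (k n) (c (S n))) -> c 0%nat = 0.
Proof.
  intros k2 E. apply NNPP. intros nx.
  destruct (aleph1_free_separating c (c 0%nat) nx) as (f & fx & fm).
  - now exists 0%nat.
  - assert (G : forall n, (f (c n) <> 0 /\ Z.abs (f (c n)) + Z.of_nat n <= Z.abs (f (c 0%nat)))%Z).
    { induction n as [|n [IH1 IH2]]; [lia|].
      specialize (fm n (k n) (S n) (E n)). specialize (k2 n). nia. }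
    specialize (G (Z.abs_nat (f (c 0%nat)))). lia.
Qed.
End AlephOneFree.

(** * Binary families of equations in strongly aleph_1-free groups *)

Lemma not_injective_countable (M : H -> Prop) (F : (nat -> bool) -> H) :
  countable_set H M -> (forall e, M (F e)) ->
  exists e d n, F e = F d /\ e n <> d n /\ forall i, (i < n)%nat -> e i = d i.
Proof.
  intros [f Hf] HF.
  assert (ex : forall n, exists d, (exists d', F d' = f n) -> F d = f n).
  { intros n. destruct (classic (exists d', F d' = f n)) as [[d E]|N].
    - now exists d.
    - now exists (fun _ => true). }
  destruct (choice _ ex) as [D HD].
  (* Cantor's diagonal: [e] differs from each [D n] at [n], yet [F e] is some [f n], so
     [F (D n) = F e]. *)
  set (e := fun n => negb (D n n)).
  destruct (Hf _ (HF e)) as [n En].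
  assert (dif : e n <> D n n) by (unfold e; now destruct (D n n)).
  destruct (dec_inh_nat_subset_has_unique_least_element (fun i => e i <> D n i))
    as (m & (Hm & least) & _).
  - intros i. apply classic.
  - now exists n.
  - exists e, (D n), m. repeat split; [|easy|].
    + rewrite HD; [easy|]. now exists e.
    + intros i Hi. apply NNPP. intros N. specialize (least i N). lia.
Qed.

(* [H/M] is again free of infinitely divisible elements, so every solution [y]
   lies in the countable group [M]; two binary sequences with the same [y 0] then
   contradict the choice of [k] at the first place where they differ. *)
Lemma no_binary_solutions (h : nat -> H) (k : nat -> nat) :
  strongly_aleph1_free H ->
  (forall n, 2 <= k n)%nat -> (forall n y, h n <> nmul H (k n) y) ->
  ~ forall e : nat -> bool, exists y : nat -> H,
      forall n, y n = (if e n then h n else 0) + nmul H (k n) (y (S n)).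
Proof.
  intros [free pure] k2 hk ex.
  destruct (choice _ ex) as [Y HY]. clear ex.
  destruct (pure (fun x => exists n, h n = x)) as (M & HM & Mgen & (_ & Mpure) & hM).
  { now exists h. }
  assert (Mc : countable_set H M).
  { destruct Mgen as (Z & Zc & EZ). destruct (gen_countable Z Zc) as [f Hf].
    exists f. intros x Mx. now apply Hf, EZ. }
  assert (Me : forall (e : nat -> bool) n, M (if e n then h n else 0)).
  { intros e n. destruct (e n); [|apply HM]. apply hM. now exists n. }
  assert (YM : forall e, M (Y e 0%nat)).
  { intros e.
    destruct (Mpure (fun x => exists n, Y e n = x)) as (C & HC & _ & disj & dec).
    { now exists (Y e). }
    assert (ex : forall n, exists p : H * H,
              M (fst p) /\ C (snd p) /\ Y e n = fst p + snd p).
    { intros n. destruct (dec (Y e n)) as (a & c & Ha & Hc & E).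
      - apply gen_incl. right. now exists n.
      - now exists (a, c). }
    destruct (choice _ ex) as [p Hp]. clear ex.
    (* The [C]-parts of the solution form a chain of divisions: the defect lies in [C], and by the
       recursion it equals a combination of [M]-parts, so it is 0. *)
    assert (Ec : forall n, snd (p n) = nmul H (k n) (snd (p (S n)))).
    { intros n. destruct (Hp n) as (Ma & Cc & E), (Hp (S n)) as (Ma' & Cc' & E').
      specialize (HY e n). rewrite E, E', nmul_add, ab_addA in HY.
      set (b := _ + nmul H _ (fst _)) in HY.
      assert (Mb : M b).
      { apply HM; [apply Me|]. now apply nmul_closed. }
      assert (Eq : snd (p n) + - nmul H (k n) (snd (p (S n))) = b + - fst (p n)).
      { apply (add_cancel_l (fst (p n))).
        rewrite ab_addA, HY, <- ab_addA, addNr.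
        now rewrite (ab_addC _ b (- _)), (ab_addA _ _ (- _)), addNr, ab_add0, add0r. }
      apply sub_eq0, disj.
      - rewrite Eq. apply HM; [easy|]. now apply HM.
      - apply HC; [easy|]. apply HC. now apply nmul_closed. }
    assert (c0 := aleph1_free_chain free k (fun n => snd (p n)) k2 Ec). simpl in c0.
    destruct (Hp 0%nat) as (Ma & _ & E). now rewrite E, c0, add0r. }
  destruct (not_injective_countable M (fun e => Y e 0%nat) Mc YM) as (e & d & n & E & N & L).
  (* Before [n] both recursions have the same summands, so torsion-freeness carries equality from
     [i] to [S i]. *)
  assert (G : forall i, (i <= n)%nat -> Y e i = Y d i).
  { induction i as [|i IH]; intros Hi; [exact E|].
    apply (nmul_injective free (k i)); [specialize (k2 i); lia|].
    apply (add_cancel_l (if e i then h i else 0)).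
    rewrite <- HY, (L i) by lia. rewrite <- HY. apply IH. lia. }
  specialize (G n (le_n n)). rewrite (HY e), (HY d) in G.
  set (u := nmul H _ _) in G at 1. set (v := nmul H _ (Y d _)) in G.
  (* At [n] exactly one of the two recursions contains [h n]; solving for it exhibits a multiple of
     [k n]. *)
  assert (K : h n = v + - u \/ h n = u + - v).
  { destruct (e n), (d n); [tauto| | |tauto]; rewrite ab_add0 in G.
    - left. rewrite <- G, <- ab_addA, addNr. now rewrite add0r.
    - right. rewrite G, <- ab_addA, addNr. now rewrite add0r. }
  unfold u, v in K. rewrite <- !nmul_opp, <- !nmul_add in K.
  destruct K as [K|K]; now apply hk in K.
Qed.
End AbelianGroup.

(** * Topological groups and kernels of homomorphisms *)

Section TopologicalGroup.
Variable G : TopGroup.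
Implicit Types (U V : G -> Prop) (x g : G).

Local Infix "*" := (tg_mul G).
Local Notation "1" := (tg_one G).

Lemma tg_mulr_inv x : x * tg_inv G x = 1.
Proof.
  rewrite <- (tg_mul1 G (x * tg_inv G x)).
  rewrite <- (tg_mulV G (tg_inv G x)) at 1.
  rewrite <- tg_mulA, (tg_mulA G (tg_inv G x) x), tg_mulV, tg_mul1. apply tg_mulV.
Qed.

Lemma tg_mulr1 x : x * 1 = x.
Proof. now rewrite <- (tg_mulV G x), tg_mulA, tg_mulr_inv, tg_mul1. Qed.

Fixpoint tg_pow (x : G) (n : nat) : G :=
  match n with O => 1 | S m => x * tg_pow x m end.

Lemma tg_pow_one n : tg_pow 1 n = 1.
Proof. induction n as [|n IH]; simpl; [easy|]. rewrite IH. apply tg_mul1. Qed.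

Lemma tg_open_local U :
  (forall x, U x -> exists V, tg_open G V /\ V x /\ forall y, V y -> U y) -> tg_open G U.
Proof.
  intros loc.
  replace U with (fun x => exists V, (tg_open G V /\ forall y, V y -> U y) /\ V x).
  - apply tg_open_union. tauto.
  - apply pred_ext. intros x. split.
    + intros (V & (_ & sub) & Vx). auto.
    + intros Ux. destruct (loc x Ux) as (V & oV & Vx & sub). now exists V.
Qed.

Definition continuous (f : G -> G) := forall U, tg_open G U -> tg_open G (fun x => U (f x)).

Lemma continuous_id : continuous (fun x => x).
Proof. easy. Qed.

Lemma continuous_const g : continuous (fun _ => g).
Proof.
  intros U oU. apply tg_open_local. intros x Ug.
  exists (fun _ => True). split; [apply tg_open_full|]. tauto.
Qed.

Lemma continuous_mul f1 f2 : continuous f1 -> continuous f2 -> continuous (fun x => f1 x * f2 x).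
Proof.
  intros c1 c2 U oU. apply tg_open_local. intros x Ux.
  destruct (tg_mul_cont G _ _ _ oU Ux) as (V & W & oV & oW & Vx & Wx & sub).
  exists (fun y => V (f1 y) /\ W (f2 y)). repeat split; [|easy|easy|].
  - apply tg_open_inter; [now apply c1|now apply c2].
  - intros y [Vy Wy]. now apply sub.
Qed.

Lemma continuous_pow n : continuous (fun x => tg_pow x n).
Proof.
  induction n as [|n IH]; simpl.
  - apply continuous_const.
  - apply continuous_mul; [apply continuous_id|apply IH].
Qed.

Lemma continuous_mul_pow g n : continuous (fun x => g * tg_pow x n).
Proof. apply continuous_mul; [apply continuous_const|apply continuous_pow]. Qed.

Section Homomorphism.
Variables (H : AbGroup) (phi : G -> H).
Hypothesis hom : tg_hom G H phi.

Lemma tg_hom1 : phi 1 = ab_zero H.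
Proof.
  apply (add_cancel_l H (phi 1)). rewrite <- hom, tg_mul1. symmetry. apply add0r.
Qed.

Lemma tg_hom_pow x n : phi (tg_pow x n) = nmul H n (phi x).
Proof.
  induction n as [|n IH]; simpl; [apply tg_hom1|]. now rewrite hom, IH.
Qed.

(** Each point [x] of the kernel has the neighbourhood [x U] inside the kernel. *)
Lemma open_kernel_local U : tg_open G U -> U 1 ->
  (forall x, U x -> phi x = ab_zero H) -> open_kernel G H phi.
Proof.
  intros oU U1 kerU. apply tg_open_local. intros x Ex.
  exists (fun y => U (tg_inv G x * y)). repeat split.
  - apply (continuous_mul (fun _ => tg_inv G x) (fun y => y)); [|apply continuous_id|easy].
    apply continuous_const.
  - now rewrite tg_mulV.
  - intros y Uy. rewrite <- (tg_mul1 G y), <- (tg_mulr_inv x), <- tg_mulA, hom, Ex.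
    rewrite (kerU _ Uy). apply ab_add0.
Qed.

Lemma not_open_kernel_ex : aleph1_free H -> ~ open_kernel G H phi ->
  forall U, tg_open G U -> U 1 -> exists (g : G) (k : nat),
    U g /\ (2 <= k)%nat /\ forall y, phi g <> nmul H k y.
Proof.
  intros free nker U oU U1.
  assert (exg : exists g, U g /\ phi g <> ab_zero H).
  { apply NNPP. intros N. apply nker, (open_kernel_local U); trivial.
    intros x Ux. apply NNPP. intros nx. apply N. now exists x. }
  destruct exg as (g & Ug & ng).
  destruct (aleph1_free_nondivisor H free _ ng) as (k & k2 & Hk). now exists g, k.
Qed.

(** [phi] carries the product recursion in [G] to the additive one excluded by
    [no_binary_solutions]. *)
Lemma no_binary_products (g : nat -> G) (k : nat -> nat) :
  strongly_aleph1_free H -> (forall n, 2 <= k n)%nat ->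
  (forall n y, phi (g n) <> nmul H (k n) y) ->
  ~ forall e : nat -> bool, exists x : nat -> G,
      forall n, x n = (if e n then g n else 1) * tg_pow (x (S n)) (k n).
Proof.
  intros sfree k2 hk sol.
  apply (no_binary_solutions H (fun n => phi (g n)) k sfree k2 hk).
  intros e. destruct (sol e) as [x Hx]. exists (fun n => phi (x n)).
  intros n. rewrite Hx at 1. rewrite hom, tg_hom_pow. f_equal.
  destruct (e n); [easy|apply tg_hom1].
Qed.
End Homomorphism.

(** * Completely metrizable groups *)

Section Metric.
Local Open Scope R_scope.
Variable d : G -> G -> R.
Hypothesis met : is_metric G d.
Hypothesis topd : forall U, tg_open G U <->
  forall x, U x -> exists eps, 0 < eps /\ forall y, d x y < eps -> U y.

Lemma metric_refl x : d x x = 0.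
Proof. now apply met. Qed.

Lemma metric_tri x y (z : G) : d x z <= d x y + d y z.
Proof. apply met. Qed.

Lemma metric_sym x y : d x y = d y x.
Proof. apply met. Qed.

Lemma ball_open x r : tg_open G (fun y => d x y < r).
Proof.
  apply topd. intros y Hy. exists (r - d x y). split; [lra|].
  intros z Hz. specialize (metric_tri x y z). lra.
Qed.

Definition converges (s : nat -> G) (x : G) : Prop :=
  forall eps, 0 < eps -> exists N, forall n, (N <= n)%nat -> d (s n) x < eps.

Lemma converges_unique s x y : converges s x -> converges s y -> x = y.
Proof.
  intros cx cy. apply met. apply NNPP. intros N.
  assert (p : 0 < d x y / 2) by (destruct (proj1 met x y); [lra|now symmetry in H]).
  destruct (cx _ p) as [n1 H1], (cy _ p) as [n2 H2].
  specialize (H1 (max n1 n2) (Nat.le_max_l _ _)).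
  specialize (H2 (max n1 n2) (Nat.le_max_r _ _)).
  specialize (metric_tri x (s (max n1 n2)) y). rewrite (metric_sym x (s _)). lra.
Qed.

Lemma converges_continuous f s x : continuous f -> converges s x ->
  converges (fun n => f (s n)) (f x).
Proof.
  intros cf cs eps pe.
  destruct (proj1 (topd _) (cf _ (ball_open (f x) eps)) x) as (r & pr & Hr).
  - now rewrite metric_refl.
  - destruct (cs r pr) as [N HN]. exists N. intros n Hn.
    rewrite metric_sym. apply Hr. rewrite metric_sym. now apply HN.
Qed.

Lemma cauchy_half_pow s : (forall n, d (s n) (s (S n)) <= (1 / 2) ^ n) ->
  forall eps, 0 < eps -> exists N, forall n k, (N <= n)%nat -> (N <= k)%nat ->
    d (s n) (s k) < eps.
Proof.
  intros step.
  (* The right-hand side is the exact geometric sum of the step bounds from [n] to [n + j - 1]. *)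
  assert (tail : forall n j, d (s n) (s (n + j)%nat) <= 2 * (1 / 2) ^ n - 2 * (1 / 2) ^ (n + j)).
  { intros n. induction j as [|j IH].
    - rewrite Nat.add_0_r, metric_refl. lra.
    - rewrite Nat.add_succ_r. specialize (step (n + j)%nat).
      specialize (metric_tri (s n) (s (n + j)%nat) (s (S (n + j)))). simpl. lra. }
  intros eps pe.
  destruct (pow_lt_1_zero (1 / 2) ltac:(rewrite Rabs_right; lra) (eps / 4) ltac:(lra)) as [N HN].
  assert (near : forall n, (N <= n)%nat -> d (s N) (s n) < eps / 2).
  { intros n Hn. specialize (tail N (n - N)%nat).
    replace (N + (n - N))%nat with n in tail by lia.
    specialize (HN N (le_n N)).
    assert (P1 := pow_lt (1 / 2) N ltac:(lra)). assert (P2 := pow_lt (1 / 2) n ltac:(lra)).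
    rewrite Rabs_right in HN; lra. }
  exists N. intros n m Hn Hm.
  specialize (metric_tri (s n) (s N) (s m)). rewrite (metric_sym (s n) (s N)).
  specialize (near n Hn) as H1. specialize (near m Hm) as H2. lra.
Qed.

Lemma continuous_list_near (L : list (G -> G)) eps : 0 < eps -> Forall continuous L ->
  exists U, tg_open G U /\ U (tg_one G) /\ forall x, U x -> Forall (fun f => d (f (tg_one G)) (f x) < eps) L.
Proof.
  intros pe. induction 1 as [|f L cf _ (U & oU & U1 & HU)].
  - exists (fun _ => True). repeat split; [apply tg_open_full|]. constructor.
  - exists (fun x => U x /\ d (f (tg_one G)) (f x) < eps). repeat split; trivial.
    + apply tg_open_inter; [easy|]. exact (cf _ (ball_open _ _)).
    + now rewrite metric_refl.
    + intros x [Ux Hx]. constructor; auto.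
Qed.
End Metric.

(* With [(g_m, k_m)] the pair chosen at stage [m], [comps choose N] lists all maps
   [t |-> g_n^{e_n} (... (g_{N-1}^{e_{N-1}} t^{k_{N-1}})^{k_{N-2}} ...)^{k_n}], where [n <= N]
   and [e] is binary. *)
Definition comps_step (p : G * nat) (L : list (G -> G)) : list (G -> G) :=
  (fun t => t) ::
  flat_map (fun f => [fun t => f (fst p * tg_pow t (snd p));
                      fun t => f (1 * tg_pow t (snd p))]) L.

Fixpoint comps (choose : nat * list (G -> G) -> G * nat) (N : nat) : list (G -> G) :=
  match N with
  | O => [fun t => t]
  | S m => comps_step (choose (m, comps choose m)) (comps choose m)
  end.

Lemma comps_step_continuous p L : Forall continuous L -> Forall continuous (comps_step p L).
Proof.
  intros cL. constructor; [apply continuous_id|].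
  apply Forall_flat_map. revert cL. apply Forall_impl. intros f cf.
  repeat constructor; intros U oU; apply (continuous_mul_pow _ _ (fun t => U (f t))), cf, oU.
Qed.

Section NestedProduct.
Variables (a : nat -> G) (k : nat -> nat).

Fixpoint comp_from (n j : nat) (t : G) : G :=
  match j with O => t | S i => a n * tg_pow (comp_from (S n) i t) (k n) end.

(** The definition unfolds the outermost factor, while successive partial products differ in the
    innermost one. *)
Lemma comp_from_S n j t :
  comp_from n (S j) t = comp_from n j (a (n + j) * tg_pow t (k (n + j))).
Proof.
  revert n. induction j as [|j IH]; intros n.
  - simpl. now rewrite Nat.add_0_r.
  - change (comp_from n (S (S j)) t) with (a n * tg_pow (comp_from (S n) (S j) t) (k n)).
    rewrite IH, Nat.add_succ_comm. easy.
Qed.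
End NestedProduct.

(* Successive partial products are made closer than [2^-N], for all binary sequences at
   once, by choosing [g N] after the finitely many continuous maps in [comps]. *)
Lemma completely_metrizable_kernel (H : AbGroup) (phi : G -> H) :
  strongly_aleph1_free H -> completely_metrizable G -> tg_hom G H phi -> open_kernel G H phi.
Proof.
  intros sfree (d & met & topd & compl) hom. apply NNPP. intros nker.
  (* At stage [N], replacing the argument 1 by the new [g] must move each map in the current list
     [L] by less than [2^-N]. *)
  assert (ex : forall p : nat * list (G -> G), exists q : G * nat, Forall continuous (snd p) ->
    Forall (fun f => d (f (tg_one G)) (f (fst q)) < (1 / 2) ^ fst p)%R (snd p) /\
    (2 <= snd q)%nat /\ forall y, phi (fst q) <> nmul H (snd q) y).
  { intros [N L]. destruct (classic (Forall continuous L)) as [cL|nL].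
    - destruct (continuous_list_near d met topd L ((1 / 2) ^ N)%R) as (U & oU & U1 & HU);
        [apply pow_lt; lra|easy|].
      destruct (not_open_kernel_ex H phi hom (proj1 sfree) nker U oU U1)
        as (g & k & Ug & k2 & Hk).
      exists (g, k). intros _. repeat split; [now apply HU|easy..].
    - exists (1, 0%nat). simpl. tauto. }
  destruct (choice _ ex) as [ch Hch]. clear ex.
  set (g := fun N => fst (ch (N, comps ch N))).
  set (k := fun N => snd (ch (N, comps ch N))).
  assert (cont : forall N, Forall continuous (comps ch N)).
  { induction N as [|N IH].
    - repeat constructor. apply continuous_id.
    - now apply comps_step_continuous. }
  assert (Hg := fun N => Hch (N, comps ch N) (cont N)).
  apply (no_binary_products H phi hom g k sfree); try (intros n; apply (Hg n)).
  intros e. set (a := fun n => if e n then g n else 1).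
  assert (Ea : forall n, a n = g n \/ a n = 1) by (intros n; unfold a; destruct (e n); auto).
  (* Whatever [e] is, its partial compositions occur in the finite lists, so the choice of [g]
     controls them. *)
  assert (mem : forall n j, In (comp_from a k n j) (comps ch (n + j))).
  { intros n. induction j as [|j IH].
    - replace (comp_from a k n 0) with (fun t : G => t) by easy.
      rewrite Nat.add_0_r. destruct n; now left.
    - replace (comp_from a k n (S j)) with
        (fun t => comp_from a k n j (a (n + j)%nat * tg_pow t (k (n + j)%nat))).
      2: { apply functional_extensionality. intros t. now rewrite comp_from_S. }
      rewrite Nat.add_succ_r. right. apply in_flat_map.
      exists (comp_from a k n j). split; [easy|].
      destruct (Ea (n + j)%nat) as [-> | ->]; simpl; auto. }
  assert (lim : forall n, exists x, converges d (fun j => comp_from a k n j 1) x).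
  { intros n. apply compl, (cauchy_half_pow d met). intros j.
    (* As powers of 1 are 1, the next partial product is the same composition evaluated at
       [a (n + j)] instead of 1. *)
    rewrite comp_from_S, tg_pow_one, tg_mulr1.
    apply Rle_trans with ((1 / 2) ^ (n + j))%R.
    - destruct (Ea (n + j)%nat) as [-> | ->].
      + apply Rlt_le. destruct (Hg (n + j)%nat) as [F _].
        rewrite Forall_forall in F. apply (F _ (mem n j)).
      + rewrite (metric_refl d met). apply pow_le. lra.
    - rewrite pow_add.
      assert (P1 := pow_lt (1 / 2) j ltac:(lra)).
      assert (P2 : ((1 / 2) ^ n <= 1)%R).
      { rewrite <- (pow1 n) at 2. apply pow_incr. lra. }
      nra. }
  destruct (choice _ lim) as [x Hx]. exists x. intros n.
  (* The shifted sequence still tends to [x n]; unfolding its outermost factor and using continuity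
     gives the other limit. *)
  apply (converges_unique d met (fun j => comp_from a k n (S j) 1)).
  - intros eps pe. destruct (Hx n eps pe) as [N HN]. exists N.
    intros j Hj. apply (HN (S j)). lia.
  - apply (converges_continuous d met topd (fun t => a n * tg_pow t (k n))).
    + apply continuous_mul_pow.
    + apply Hx.
Qed.

(** * Locally compact Hausdorff groups *)

Definition cluster_point (u : nat -> G) (x : G) : Prop :=
  forall U, tg_open G U -> U x -> forall N, exists n, (N <= n)%nat /\ U (u n).

(* Otherwise the open sets [O] that keep [f (u n)] away from [x], for large [n] with
   [u n] in [O], cover [K]. *)
Lemma cluster_point_lift (K : G -> Prop) (f : G -> G) (u : nat -> G) (x : G) :
  hausdorff G -> compact_set G K -> continuous f -> (forall n, K (u n)) ->
  cluster_point (fun n => f (u n)) x -> exists y, cluster_point u y /\ f y = x.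
Proof.
  intros haus comp cf Ku cl. apply NNPP. intros N.
  set (F := fun O : G -> Prop => tg_open G O /\ exists Q M, tg_open G Q /\ Q x /\
              forall n, (M <= n)%nat -> O (u n) -> ~ Q (f (u n))).
  destruct (comp F) as (l & Fl & cov).
  - now intros O [oO _].
  (* If [f y = x], then [y] is not a cluster point of [u]; otherwise the Hausdorff property
     separates [f y] from [x]. *)
  - intros y _. destruct (classic (f y = x)) as [E|E].
    + assert (ncl : ~ cluster_point u y) by (intros c; apply N; now exists y).
      apply NNPP. intros N'. apply ncl. intros U oU Uy M. apply NNPP. intros N2.
      apply N'. exists U. split; [|easy]. split; [easy|].
      exists (fun _ => True), M. repeat split; [apply tg_open_full|].
      intros n Hn Un _. apply N2. now exists n.
    + destruct (haus _ _ E) as (U & V & oU & oV & Uf & Vx & disj).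
      exists (fun z => U (f z)). split; [|easy]. split; [now apply cf|].
      exists V, 0%nat. repeat split; trivial. intros n _ Un Vn. now apply (disj (f (u n))).
  - assert (unif : exists Q M, tg_open G Q /\ Q x /\
        forall n, (M <= n)%nat -> forall O, In O l -> O (u n) -> ~ Q (f (u n))).
    { clear cov. induction Fl as [|O l (_ & Q & M & oQ & Qx & HQ) _ (Q' & M' & oQ' & Qx' & HQ')].
      - exists (fun _ => True), 0%nat. repeat split; [apply tg_open_full|]. now intros ? ? ? [].
      - exists (fun z => Q z /\ Q' z), (max M M'). repeat split; trivial.
        + now apply tg_open_inter.
        + intros n Hn O' [<-|I] On [q q'].
          * apply (HQ n); [lia|easy..].
          * apply (HQ' n) with O'; [lia|easy..]. }
    destruct unif as (Q & M & oQ & Qx & HQ).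
    destruct (cl Q oQ Qx M) as (n & Hn & Qn).
    destruct (cov _ (Ku n)) as (O & IO & On). now apply (HQ n Hn O).
Qed.

(** A constant map reduces this to lifting. Cluster points replace convergent subsequences, which
    compactness alone does not supply. *)
Lemma compact_cluster_point (K : G -> Prop) (u : nat -> G) :
  hausdorff G -> compact_set G K -> (forall n, K (u n)) -> exists y, cluster_point u y.
Proof.
  intros haus comp Ku.
  destruct (cluster_point_lift K (fun _ => 1) u 1 haus comp) as (y & Hy & _); trivial.
  - apply continuous_const.
  - intros U oU U1 N. now exists N.
  - now exists y.
Qed.

(** The [V n] shrink so that [t] in [V (S n)] puts [g n * t^(k n)] and [t^(k n)] in [V n]; hence all
    partial products stay in [K]. A cluster point of those starting at 0 is then lifted one factor
    at a time. *)
Lemma locally_compact_kernel (H : AbGroup) (phi : G -> H) :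
  strongly_aleph1_free H -> locally_compact G -> hausdorff G ->
  tg_hom G H phi -> open_kernel G H phi.
Proof.
  intros sfree lc haus hom. apply NNPP. intros nker.
  destruct (lc 1) as (V0 & K & oV0 & V01 & V0K & Kc).
  assert (ex : forall V, exists q : G * nat * (G -> Prop), tg_open G V /\ V 1 ->
    ((2 <= snd (fst q))%nat /\ forall y, phi (fst (fst q)) <> nmul H (snd (fst q)) y) /\
    (tg_open G (snd q) /\ snd q 1) /\
    forall t, snd q t -> V t /\ V (fst (fst q) * tg_pow t (snd (fst q))) /\
                         V (1 * tg_pow t (snd (fst q)))).
  { intros V. destruct (classic (tg_open G V /\ V 1)) as [[oV V1]|nV].
    - destruct (not_open_kernel_ex H phi hom (proj1 sfree) nker V oV V1)
        as (g & k & Vg & k2 & Hk).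
      exists (g, k, fun t => V t /\ V (g * tg_pow t k) /\ V (1 * tg_pow t k)).
      intros _. split; [easy|]. split; [|easy]. split.
      + repeat apply tg_open_inter; trivial; exact (continuous_mul_pow _ _ V oV).
      + simpl. now rewrite tg_pow_one, !tg_mulr1.
    - exists (1, 0%nat, V). tauto. }
  destruct (choice _ ex) as [ch Hch]. clear ex.
  set (V := nat_rect (fun _ => G -> Prop) V0 (fun _ V => snd (ch V))).
  assert (oV : forall n, tg_open G (V n) /\ V n 1).
  { induction n as [|n IH]; [easy|]. now apply (Hch (V n)). }
  assert (HV := fun n => Hch (V n) (oV n)).
  set (g := fun n => fst (fst (ch (V n)))) in *.
  set (k := fun n => snd (fst (ch (V n)))) in *.
  apply (no_binary_products H phi hom g k sfree); try (intros n; apply (HV n)).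
  intros e. set (a := fun n => if e n then g n else 1).
  assert (Ea : forall n, a n = g n \/ a n = 1) by (intros n; unfold a; destruct (e n); auto).
  set (u := fun n j => comp_from a k n j 1).
  assert (uV : forall j n, V n (u n j)).
  { induction j as [|j IH]; intros n.
    - apply oV.
    - unfold u. simpl. destruct (HV n) as (_ & _ & sub).
      destruct (sub _ (IH (S n))) as (_ & v1 & v2). destruct (Ea n) as [-> | ->]; [apply v1|apply v2]. }
  assert (uK : forall n j, K (u n j)).
  { intros n j. apply V0K. specialize (uV j n). revert uV. generalize (u n j).
    induction n as [|n IH]; intros t Vt; [easy|]. apply IH. now apply (HV n). }
  assert (step : forall p : nat * G, exists y, cluster_point (u (fst p)) (snd p) ->
            cluster_point (u (S (fst p))) y /\ a (fst p) * tg_pow y (k (fst p)) = snd p).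
  { intros [n x]. destruct (classic (cluster_point (u n) x)) as [cl|ncl].
    - destruct (cluster_point_lift K (fun y => a n * tg_pow y (k n)) (u (S n)) x haus Kc)
        as [y Hy]; [apply continuous_mul_pow|apply uK| |now exists y].
      (* Asking for an index at least [S N] yields a successor [S j], where [u n (S j)] unfolds to
         [a n * (u (S n) j)^(k n)]. *)
      intros U oU Ux N. destruct (cl U oU Ux (S N)) as ([|j] & Hj & Uj); [lia|].
      exists j. split; [lia|exact Uj].
    - exists 1. simpl. tauto. }
  destruct (choice _ step) as [next Hnext]. clear step.
  destruct (compact_cluster_point K (u 0%nat) haus Kc (uK 0%nat)) as [x0 Hx0].
  set (x := nat_rect (fun _ => tg_car G) x0 (fun n y => next (n, y))).
  assert (clx : forall n, cluster_point (u n) (x n)).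
  { induction n as [|n IH]; [easy|]. now apply (Hnext (n, x n)). }
  exists x. intros n. symmetry. apply (Hnext (n, x n)), clx.
Qed.
End TopologicalGroup.

(** * Words, their equivalence and subwords *)

Lemma StronglySorted_unique {T : Type} (lt : T -> T -> Prop) :
  (forall x, ~ lt x x) -> (forall x y z, lt x y -> lt y z -> lt x z) ->
  forall l l', StronglySorted lt l -> StronglySorted lt l' ->
    (forall x, In x l <-> In x l') -> l = l'.
Proof.
  intros irr tr. induction l as [|x l IH]; intros [|y l'] Sl Sl' E; trivial.
  - destruct (proj2 (E y) (or_introl eq_refl)).
  - destruct (proj1 (E x) (or_introl eq_refl)).
  - inversion_clear Sl as [|? ? Sl1 Fx]. inversion_clear Sl' as [|? ? Sl1' Fy].
    rewrite Forall_forall in Fx, Fy.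
    assert (x = y).
    { destruct (proj1 (E x) (or_introl eq_refl)) as [e|I]; [easy|].
      destruct (proj2 (E y) (or_introl eq_refl)) as [e|I']; [easy|].
      destruct (irr x). eauto. }
    subst y. f_equal. apply IH; trivial. intros z. split; intros I.
    + destruct (proj1 (E z) (or_intror I)) as [e|]; [|easy].
      subst z. now destruct (irr x (Fx x I)).
    + destruct (proj2 (E z) (or_intror I)) as [e|]; [|easy].
      subst z. now destruct (irr x (Fy x I)).
Qed.

(** The image under [f] of a sorted enumeration for [W] is one for [U], which is unique; the
    projections agree even before free reduction. *)
Lemma word_equiv_iso (W U : RawWord) (f : w_dom W -> w_dom U) : is_word U ->
  (forall i j, w_lt W i j -> w_lt U (f i) (f j)) -> (forall u, exists i, f i = u) ->
  (forall i, w_let U (f i) = w_let W i) -> word_equiv W U.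
Proof.
  intros (irr & tr & _) mono surj lets m l1 l2 (ds1 & I1 & S1 & ->) (ds2 & I2 & S2 & ->).
  replace ds2 with (map f ds1).
  - rewrite map_map. rewrite (map_ext (fun i => w_let U (f i)) (w_let W)) by exact lets.
    apply rst_refl.
  - apply (StronglySorted_unique (w_lt U)); trivial.
    + clear I1. induction S1 as [|i l S IH F]; simpl; constructor; [easy|].
      apply Forall_map. revert F. apply Forall_impl. auto.
    + intros u. rewrite I2, in_map_iff. split.
      * intros (i & <- & I). rewrite lets. now apply I1.
      * destruct (surj u) as [i <-]. rewrite lets. intros Hi.
        exists i. split; [easy|]. now apply I1.
Qed.

(** Convertible to [word_restrict m W] when [P] bounds the letter index by [m]. *)
Definition subword (W : RawWord) (P : w_dom W -> Prop) : RawWord := {|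
  w_dom := { i : w_dom W | P i };
  w_lt := fun a b => w_lt W (proj1_sig a) (proj1_sig b);
  w_let := fun a => w_let W (proj1_sig a)
|}.

Lemma sig_eq {T : Type} {P : T -> Prop} (a b : { i : T | P i }) :
  proj1_sig a = proj1_sig b -> a = b.
Proof.
  destruct a as [i p], b as [j q]. simpl. intros E. subst j. f_equal. apply proof_irrelevance.
Qed.

Lemma is_word_subword W P : is_word W -> is_word (subword W P).
Proof.
  intros (irr & tr & tot & fin). split; [|split; [|split]].
  - intros [i p]. apply irr.
  - intros [i p] [j q] [l r]. apply tr.
  - intros a b. destruct (tot (proj1_sig a) (proj1_sig b)) as [L|[E|L]]; auto.
    right. left. now apply sig_eq.
  - intros m. destruct (fin m) as [l Hl].
    assert (sub : exists l' : list { i | P i }, forall a, In (proj1_sig a) l -> In a l').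
    { clear Hl. induction l as [|i l [l' IH]].
      - exists []. easy.
      - destruct (classic (P i)) as [p|np].
        + exists (exist _ i p :: l'). intros a [E|I].
          * left. now apply sig_eq.
          * right. auto.
        + exists l'. intros [j q] [E|I]; [|auto]. simpl in E. now subst j. }
    destruct sub as [l' Hl']. exists l'. intros a Ha. apply Hl', Hl, Ha.
Qed.

Lemma is_word_concat W U : is_word W -> is_word U -> is_word (word_concat W U).
Proof.
  intros (irr & tr & tot & fin) (irr' & tr' & tot' & fin'). split; [|split; [|split]].
  - intros [i|i]; [apply irr|apply irr'].
  - intros [i|i] [j|j] [l|l]; simpl; try tauto; [apply tr|apply tr'].
  - intros [i|i] [j|j]; simpl; auto.
    + destruct (tot i j) as [L|[E|L]]; subst; auto.
    + destruct (tot' i j) as [L|[E|L]]; subst; auto.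
  - intros m. destruct (fin m) as [l Hl], (fin' m) as [l' Hl'].
    exists (map inl l ++ map inr l'). intros [i|i] Hi; apply in_or_app.
    + left. apply in_map. auto.
    + right. apply in_map. auto.
Qed.

(** * Infinite nested words *)

Section NestedWord.
Variables (g : nat -> RawWord) (k : nat -> nat).

(* Positions of the word [X_n = g_n X_{n+1} ... X_{n+1}], with [k n] copies of [X_{n+1}]. *)
Inductive nest (n : nat) : Type :=
  | nhere (i : w_dom (g n))
  | nthere (c : nat) (hc : c < k n) (a : nest (S n)).
Arguments nhere {n} i.
Arguments nthere {n} c hc a.

Fixpoint nest_lt {n : nat} (a b : nest n) {struct a} : Prop :=
  match a, b with
  | nhere i, nhere j => w_lt (g n) i j
  | nhere _, nthere _ _ _ => True
  | nthere _ _ _, nhere _ => False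
  | nthere c _ a', nthere c' _ b' => c < c' \/ c = c' /\ nest_lt a' b'
  end.

Fixpoint nest_let {n : nat} (a : nest n) : letter :=
  match a with nhere i => w_let (g n) i | nthere _ _ a' => nest_let a' end.

Definition nested_word (n : nat) : RawWord :=
  {| w_dom := nest n; w_lt := nest_lt; w_let := nest_let |}.

Hypothesis gword : forall n, is_word (g n).
Hypothesis glet : forall n i, n <= fst (w_let (g n) i).

Lemma nest_let_ge n (a : nest n) : n <= fst (nest_let a).
Proof.
  induction a as [n i|n c hc a IH]; simpl; [apply glet|lia].
Qed.

(** Finiteness holds because the letters of [g n] have index at least [n]: only finitely many levels
    contribute indices up to [m], each with finitely many copies. *)
Lemma is_word_nested n : is_word (nested_word n).
Proof.
  split; [|split; [|split]].
  - intros a. simpl in a. induction a as [n i|n c hc a IH]; simpl in *.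
    + apply gword.
    + intros [L|[_ L]]; [lia|tauto].
  - intros a. simpl in a. induction a as [n i|n c hc a IH]; intros [j|c' hc' b] [l|c'' hc'' d];
      simpl in *; try tauto.
    + apply gword.
    + intros [L|[E L]] [L'|[E' L']]; [lia..|]. right. split; [lia|]. eapply IH; eauto.
  - intros a. simpl in a. induction a as [n i|n c hc a IH]; intros [j|c' hc' b]; simpl in *; auto.
    + destruct (proj1 (proj2 (proj2 (gword n))) i j) as [L|[E|L]]; subst; auto.
    + destruct (lt_eq_lt_dec c c') as [[L|E]|L]; auto. subst c'.
      rewrite (proof_irrelevance _ hc' hc).
      destruct (IH b) as [L|[E|L]]; subst; auto.
  - intros m. cut (forall j n, m < n + j -> exists l : list (nest n),
      forall a, fst (nest_let a) <= m -> In a l).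
    { intros C. apply (C (S m)). lia. }
    clear n. induction j as [|j IH]; intros n Hn.
    + exists []. intros a Ha. specialize (nest_let_ge n a). lia.
    + destruct (IH (S n)) as [l Hl]; [lia|].
      destruct (proj2 (proj2 (proj2 (gword n))) m) as [lg Hlg].
      assert (copies : forall c, exists l' : list (nest n), forall c' hc' a,
                c' < c -> fst (nest_let a) <= m -> In (nthere c' hc' a) l').
      { induction c as [|c [l' IHc]].
        - exists []. lia.
        - destruct (lt_dec c (k n)) as [hc|nc].
          + exists (map (nthere c hc) l ++ l'). intros c' hc' a Hc Ha. apply in_or_app.
            destruct (Nat.eq_dec c' c) as [E|E].
            * left. subst c'. rewrite (proof_irrelevance _ hc' hc). apply in_map. auto.
            * right. apply IHc; [lia|easy].
          + exists l'. intros c' hc' a Hc Ha. apply IHc; [lia|easy]. }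
      destruct (copies (k n)) as [l' Hl'].
      exists (map nhere lg ++ l'). intros [i|c hc a] Ha; apply in_or_app.
      * left. apply in_map, Hlg, Ha.
      * right. now apply Hl'.
Qed.
End NestedWord.
Arguments nhere {g k n} i.
Arguments nthere {g k n} c hc a.

(** * Homomorphisms from the Hawaiian earring group *)

Section HawaiianHom.
Variables (H : AbGroup) (phi : RawWord -> H).
Hypothesis hom : hawaiian_hom H phi.
Local Open Scope ab_scope.

Lemma hom_iso (W U : RawWord) (f : w_dom W -> w_dom U) : is_word W -> is_word U ->
  (forall i j, w_lt W i j -> w_lt U (f i) (f j)) -> (forall u, exists i, f i = u) ->
  (forall i, w_let U (f i) = w_let W i) -> phi W = phi U.
Proof.
  intros wW wU mono surj lets. apply (proj1 hom); trivial. now apply word_equiv_iso with f.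
Qed.

(** A downward closed [L] is a cut of the order, so the word is the concatenation of its two
    sides. *)
Lemma hom_split W (P L : w_dom W -> Prop) : is_word W ->
  (forall i j, w_lt W i j -> L j -> L i) ->
  phi (subword W P) =
  phi (subword W (fun i => P i /\ L i)) + phi (subword W (fun i => P i /\ ~ L i)).
Proof.
  intros wW down. rewrite <- (proj2 hom) by now apply is_word_subword.
  symmetry. unshelve eapply hom_iso.
  - intros [a|a]; exists (proj1_sig a); apply (proj2_sig a).
  - apply is_word_concat; now apply is_word_subword.
  - now apply is_word_subword.
  - intros [[i [Pi Li]]|[i [Pi Li]]] [[j [Pj Lj]]|[j [Pj Lj]]]; simpl; trivial; [|easy].
    intros _. destruct wW as (_ & _ & tot & _).
    destruct (tot i j) as [T|[E|T]]; [easy| |].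
    + now subst j.
    + destruct Lj. now apply (down j i).
  - intros [i p]. destruct (classic (L i)) as [l|l].
    + exists (inl (exist _ i (conj p l))). now apply sig_eq.
    + exists (inr (exist _ i (conj p l))). now apply sig_eq.
  - now intros [a|a].
Qed.

(** Splitting the empty word gives two empty words, so its image [v] satisfies [v + v = v]. *)
Lemma hom_subword_empty W (P : w_dom W -> Prop) : is_word W ->
  (forall i, ~ P i) -> phi (subword W P) = 0.
Proof.
  intros wW nP. apply (add_cancel_l H (phi (subword W P))).
  rewrite add0r. rewrite (hom_split W P (fun _ => True)) at 3 by easy.
  f_equal; f_equal; f_equal; apply pred_ext; intros i; specialize (nP i); tauto.
Qed.

Lemma hom_subword_full W (P : w_dom W -> Prop) : is_word W ->
  (forall i, P i) -> phi (subword W P) = phi W.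
Proof.
  intros wW full. unshelve eapply hom_iso.
  - exact (fun a => proj1_sig a).
  - now apply is_word_subword.
  - easy.
  - easy.
  - intros i. now exists (exist _ i (full i)).
  - easy.
Qed.

(** The finitely many positions of index at most [m] cut [W] into single letters and stretches of
    larger letters; [phi] kills the stretches. *)
Lemma hom_restrict m W : is_word W ->
  (forall P, (forall i, P i -> m < fst (w_let W i)) -> phi (subword W P) = 0) ->
  phi W = phi (word_restrict m W).
Proof.
  intros wW tail. pose (low := fun i => fst (w_let W i) <= m).
  change (word_restrict m W) with (subword W low).
  assert (G : forall l (P : w_dom W -> Prop), (forall i, P i -> low i -> In i l) ->
            phi (subword W P) = phi (subword W (fun i => P i /\ low i))).
  { assert (irr := proj1 wW). assert (tr := proj1 (proj2 wW)).
    induction l as [|i l IH]; intros P HP.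
    - rewrite tail, hom_subword_empty; trivial.
      + intros i [Pi Li]. now apply (HP i).
      + intros i Pi. destruct (Nat.lt_ge_cases m (fst (w_let W i))) as [?|g]; [easy|].
        destruct (HP i Pi g).
    - destruct (classic (P i /\ low i)) as [[Pi Li]|N].
      (* Cut into the part before [i], the position [i] itself and the part after it. *)
      + assert (sp : forall Q : w_dom W -> Prop, phi (subword W Q) =
          phi (subword W (fun j => Q j /\ w_lt W j i)) +
          (phi (subword W (fun j => (Q j /\ ~ w_lt W j i) /\ (w_lt W j i \/ j = i))) +
           phi (subword W (fun j => (Q j /\ ~ w_lt W j i) /\ ~ (w_lt W j i \/ j = i))))).
        { intros Q. rewrite <- hom_split; [|easy|].
          - apply hom_split; [easy|]. intros; eauto.
          - intros a b ab [b1|b1]; left; [eauto|now subst b]. }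
        rewrite (sp P), (sp (fun j => P j /\ low j)). clear sp.
        rewrite (IH (fun j => P j /\ w_lt W j i)).
        2: { intros j [Pj Lj] lj. destruct (HP j Pj lj) as [E|]; [|easy].
             subst j. now destruct (irr i). }
        rewrite (IH (fun j => (P j /\ ~ w_lt W j i) /\ ~ (w_lt W j i \/ j = i))).
        2: { intros j [[Pj _] Lj] lj. destruct (HP j Pj lj) as [E|]; [|easy].
             subst j. tauto. }
        f_equal; [|f_equal]; f_equal; f_equal; apply pred_ext; intros j; try tauto.
        split; [|tauto]. intros [[Pj nj] [lj|ej]]; [tauto|]. subst j. tauto.
      + apply IH. intros j Pj lj. destruct (HP j Pj lj) as [E|]; [|easy].
        subst j. tauto. }
  destruct (proj2 (proj2 (proj2 wW)) m) as [l Hl].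
  rewrite <- (hom_subword_full W (fun _ => True)) by easy.
  rewrite (G l) by auto. f_equal. f_equal. apply pred_ext. tauto.
Qed.

Lemma hom_nested (g : nat -> RawWord) (k : nat -> nat) n :
  (forall n, is_word (g n)) -> (forall n i, (n <= fst (w_let (g n) i))%nat) ->
  phi (nested_word g k n) = phi (g n) + nmul H (k n) (phi (nested_word g k (S n))).
Proof.
  intros gw gl. assert (wX := is_word_nested g k gw gl).
  (* [low c] is the initial segment made of [g n] and the first [c] copies of the next word. *)
  pose (low := fun c (a : nest g k n) => match a with nhere _ => True | nthere c' _ _ => c' < c end).
  assert (G : forall c, (c <= k n)%nat -> phi (subword (nested_word g k n) (low c)) =
            phi (g n) + nmul H c (phi (nested_word g k (S n)))).
  { induction c as [|c IH]; intros Hc; cbn [nmul].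
    - rewrite add0r. symmetry. unshelve eapply hom_iso.
      + intros i. now exists (nhere i).
      + apply gw.
      + now apply is_word_subword.
      + easy.
      + intros [[i|c hc a] p]; [|simpl in p; lia]. exists i. now apply sig_eq.
      + easy.
    - rewrite (hom_split (nested_word g k n) _ (low c)); [|easy|].
      + rewrite (ab_addC _ (phi (nested_word g k (S n)))), ab_addA, <- IH by lia. f_equal.
        * f_equal. f_equal. apply pred_ext. intros [i|c' hc a]; simpl; lia.
        * symmetry. unshelve eapply hom_iso.
          -- intros a. exists (nthere c Hc a). simpl. lia.
          -- easy.
          -- now apply is_word_subword.
          -- simpl. auto.
          -- intros [[i|c' hc a] p]; assert (p' := p); unfold low in p'; simpl in p'; [tauto|].
             assert (c' = c) by lia. subst c'.
             exists a. apply sig_eq. simpl. f_equal. apply proof_irrelevance.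
          -- easy.
      + intros [i|c1 h1 a1] [j|c2 h2 a2]; simpl; try tauto. lia. }
  rewrite <- G by easy. symmetry. apply hom_subword_full; [easy|].
  intros [i|c hc a]; simpl; [easy|lia].
Qed.

Lemma hom_factors : strongly_aleph1_free H ->
  exists m, forall W, is_word W -> phi W = phi (word_restrict m W).
Proof.
  intros sfree. apply NNPP. intros N.
  assert (ex : forall n, exists q : RawWord * nat, is_word (fst q) /\
    (forall i, n <= fst (w_let (fst q) i)) /\
    (2 <= snd q)%nat /\ forall y, phi (fst q) <> nmul H (snd q) y).
  { intros n. apply NNPP. intros N1. apply N. exists n. intros W wW.
    apply hom_restrict; [easy|]. intros P HP. apply NNPP. intros nz.
    destruct (aleph1_free_nondivisor H (proj1 sfree) _ nz) as (k & k2 & Hk).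
    apply N1. exists (subword W P, k). split; [|split; [|easy]].
    - now apply is_word_subword.
    - intros [i p]. apply Nat.lt_le_incl. exact (HP i p). }
  destruct (choice _ ex) as [q Hq]. clear ex N.
  (* The empty word serves as the factor where [e n] is false: its image is 0 and it meets the bound
     on letters vacuously. *)
  pose (empty := subword (fst (q 0%nat)) (fun _ => False)).
  assert (wE : is_word empty) by (apply is_word_subword, Hq).
  apply (no_binary_solutions H (fun n => phi (fst (q n))) (fun n => snd (q n)) sfree);
    try (intros n; apply (Hq n)).
  intros e. set (g := fun n => if e n then fst (q n) else empty).
  exists (fun n => phi (nested_word g (fun n => snd (q n)) n)). intros n.
  rewrite hom_nested.
  - f_equal. unfold g. destruct (e n); [easy|]. apply hom_subword_empty; [apply Hq|easy].
  - intros i. unfold g. destruct (e i); [apply Hq|easy].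
  - intros i. unfold g. destruct (e i); [apply Hq|now intros [? []]].
Qed.
End HawaiianHom.

Theorem theoremD : forall H : AbGroup,
  strongly_aleph1_free H -> n_slender H /\ cm_slender H /\ lcH_slender H.
Proof.
  intros H sfree. split; [|split].
  - intros phi hom. now apply hom_factors.
  - intros G cm phi hom. now apply completely_metrizable_kernel.
  - intros G lc haus phi hom. now apply locally_compact_kernel.
Qed.
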